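(* Let $\Omega,\Omega'\in\mathrm{RTSeq}_n$ and suppose $\Omega$ and $\Omega'$ have the same image in the augmented Thompson monoid $\widetilde{\mathrm{Th}}$. Then $$u(\Omega)^{-1}\cdot X(\Omega)=u(\Omega')^{-1}\cdot X(\Omega')\subset\mathrm{Fl}_n,$$ where a permutation acts on $\mathrm{Fl}_n=GL_n/B$ by left multiplication by its permutation matrix.
   Context: The augmented Thompson monoid $\widetilde{\mathrm{Th}}$ is the quotient of the free monoid on letters $\{T_j,R_j: j\ge1\}$ by the relations $T_iT_j=T_jT_{i+1}$ for $i>j$; $T_iR_j=R_jT_{i+1}$ for $i\ge j$; $R_iT_j=T_jR_{i+1}$ for $i>j$; $R_iR_j=R_jR_{i+1}$ for $i\ge j$. $\mathrm{Fl}_n=GL_n(\mathbb C)/B$ with $B$ upper triangular, $B^-$ lower triangular; $X^w=\overline{BwB/B}$, $X_w=\overline{B^-wB/B}$, Richardson variety $X^v_u=X^v\cap X_u$. For $w\in S_m$ and $1\le i\le m+1$, $\epsilon_i(w)\in S_{m+1}$ is defined by $\epsilon_i(w)(j)=w(j)+1$ for $j<i$, $\epsilon_i(w)(i)=1$, $\epsilon_i(w)(j)=w(j-1)+1$ for $j>i$. $\mathrm{RTSeq}_n$ is the set of words $\Omega=X_1\cdots X_n$ with $X_i\in\{R_1,T_1,\dots,R_{i-1},T_{i-1},R_i\}$. Recursively $u(\emptyset)=v(\emptyset)=\mathrm{id}$, and for $\Omega=\Omega'X$: $(u,v)(\Omega)=(\epsilon_ju(\Omega'),\epsilon_jv(\Omega'))$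 if $X=R_j$, $(\epsilon_ju(\Omega'),\epsilon_{j+1}v(\Omega'))$ if $X=T_j$. Set $X(\Omega)=X^{v(\Omega)}_{u(\Omega)}$. *)

(* Defs.v *)
From HB Require Import structures.
From mathcomp Require Import all_boot all_order all_algebra all_fingroup.
From mathcomp Require Import reals complex.
Set Implicit Arguments. Unset Strict Implicit. Unset Printing Implicit Defensive.
Import GRing.Theory Num.Theory.
Local Open Scope ring_scope.

(* ---------- Words in the letters T_j, R_j (indices are 1-based nats) ---- *)
Inductive letter := LT of nat | LR of nat.

Definition thRel (p q : seq letter) : Prop :=
  exists i j : nat, (1 <= j)%N /\
   [\/ (j < i)%N /\ p = [:: LT i; LT j] /\ q = [:: LT j; LT i.+1],
       (j <= i)%N /\ p = [:: LT i; LR j] /\ q = [:: LR j; LT i.+1],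
       (j < i)%N /\ p = [:: LR i; LT j] /\ q = [:: LT j; LR i.+1] |
       (j <= i)%N /\ p = [:: LR i; LR j] /\ q = [:: LR j; LR i.+1]].

(* The congruence on the free monoid generated by these relations:
   thEq w w' <-> w and w' have the same image in the augmented Thompson
   monoid. *)
Inductive thEq : seq letter -> seq letter -> Prop :=
| thEq_refl w : thEq w w
| thEq_sym w w' : thEq w w' -> thEq w' w
| thEq_trans w1 w2 w3 : thEq w1 w2 -> thEq w2 w3 -> thEq w1 w3
| thEq_step x y p q : thRel p q -> thEq (x ++ p ++ y) (x ++ q ++ y).

Definition RTSeq (n : nat) (w : seq letter) : Prop :=
  size w = n /\
  forall k : nat, (k < n)%N ->
    (* position i = k+1 *)
    match nth (LR 0) w k with
    | LR j => (1 <= j <= k.+1)%N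
    | LT j => (1 <= j <= k)%N
    end.

(* epsilon_i(w) for w in S_m, 1 <= i <= m+1 ; here with 0-based index i0 = i-1:
   eps i0 w maps i0 to 0, j < i0 to w(j)+1 and j > i0 to w(j-1)+1.
   This is exactly lift_perm i0 ord0 w. *)
Definition eps (m : nat) (i0 : 'I_m.+1) (w : 'S_m) : 'S_m.+1 :=
  lift_perm i0 ord0 w.

(* (u, v) of a word, computed on the reversed word (last letter first). *)
Fixpoint uvRev (r : seq letter) : 'S_(size r) * 'S_(size r) :=
  match r return 'S_(size r) * 'S_(size r) with
  | [::] => (1%g, 1%g)
  | X :: r' =>
      let uv := uvRev r' in
      match X with
      | LR j => (eps (inord j.-1) uv.1, eps (inord j.-1) uv.2)
      | LT j => (eps (inord j.-1) uv.1, eps (inord j) uv.2)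
      end
  end.

Definition uOf (n : nat) (w : seq letter) : 'S_n :=
  match size (rev w) =P n with
  | ReflectT e => cast_perm e (uvRev (rev w)).1
  | ReflectF _ => 1%g
  end.

Definition vOf (n : nat) (w : seq letter) : 'S_n :=
  match size (rev w) =P n with
  | ReflectT e => cast_perm e (uvRev (rev w)).2
  | ReflectF _ => 1%g
  end.

Section Flags.
Variable (R : realType) (n : nat).
Local Notation C := (R[i]).
Local Notation M := 'M[C]_n.

Definition pmat (w : 'S_n) : M := \matrix_(i, j) ((w j == i)%:R).

Definition upperB (b : M) : Prop :=
  b \in unitmx /\ forall i j : 'I_n, (j < i)%N -> b i j = 0.
Definition lowerB (b : M) : Prop :=
  b \in unitmx /\ forall i j : 'I_n, (i < j)%N -> b i j = 0.

Inductive polyfun : (M -> C) -> Prop :=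
| pf_cst c : polyfun (fun _ => c)
| pf_coord i j : polyfun (fun A => A i j)
| pf_add f g : polyfun f -> polyfun g -> polyfun (fun A => f A + g A)
| pf_mul f g : polyfun f -> polyfun g -> polyfun (fun A => f A * g A).

Definition zclosure (S : M -> Prop) (g : M) : Prop :=
  forall f, polyfun f -> (forall h, S h -> f h = 0) -> f g = 0.

(* Subsets of Fl_n = GL_n / B are represented by their (right B-invariant)
   preimages in GL_n. *)
Definition schubert (w : 'S_n) (g : M) : Prop :=
  g \in unitmx /\
  zclosure (fun h => exists b1 b2, upperB b1 /\ upperB b2 /\
                                   h = b1 *m pmat w *m b2) g.

Definition opp_schubert (w : 'S_n) (g : M) : Prop :=
  g \in unitmx /\
  zclosure (fun h => exists b1 b2, lowerB b1 /\ upperB b2 /\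
                                   h = b1 *m pmat w *m b2) g.

Definition richardson (v u : 'S_n) (g : M) : Prop :=
  schubert v g /\ opp_schubert u g.

Definition translate (w : 'S_n) (S : M -> Prop) (g : M) : Prop :=
  exists h, S h /\ g = pmat w *m h.

End Flags.

Definition XOf (R : realType) (n : nat) (w : seq letter) : 'M[R[i]]_n -> Prop :=
  richardson (vOf n w) (uOf n w).

(* Main.v *)
Require Import Defs.
From HB Require Import structures.
From mathcomp Require Import all_boot all_order all_algebra all_fingroup.
From mathcomp Require Import reals complex.
From mathcomp Require Import zify ring.
From Stdlib Require Import FunctionalExtensionality.
Set Implicit Arguments. Unset Strict Implicit. Unset Printing Implicit Defensive.
Import GRing.Theory Num.Theory.
Local Open Scope ring_scope.

(** Put Y(w) = u(w)^-1 X(w).  Appending a letter to w changes Y(w) by an operator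
that depends only on the letter: R_j inserts a row and a column with a 1 at
(j, j) and saturates on the right by B, and T_j does the same with B replaced by
the minimal parabolic subgroup P_j.  These operators satisfy the relations of
the augmented Thompson monoid because parabolic subgroups attached to
non-adjacent simple roots commute.

The recursion is a statement about Zariski closures, proved without Bruhat
order.  A generic element of P_j is a transvection times an upper triangular
matrix, which makes the relevant closures P_j-stable.  For g in the new
Richardson variety the first row of g vanishes before column j, while g^-1 e_1
vanishes after position j (j + 1 for T_j), so an explicit factorization writes g
as an inserted matrix times an element of P_j.  Deleting the inserted row and
column, resp. taking the polynomial Schur complement of the inserted 1, maps
the cells of the new Schubert, resp. opposite Schubert, variety into those of
the old one, wherever the result is invertible. *)

(** * Matrices with an inserted row and column *)

Section BlockUpper.
Variable F : fieldType.

Definition insmx n (i j : 'I_n.+1) (h : 'M[F]_n) : 'M[F]_n.+1 :=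
  \matrix_(a, b) match unlift i a, unlift j b with
    | Some a', Some b' => h a' b'
    | None, None => 1
    | _, _ => 0
    end.

Section Insertion.
Variable n : nat.
Implicit Types (h : 'M[F]_n) (i j k : 'I_n.+1).

Lemma insmx_id i j h : insmx i j h i j = 1.
Proof. by rewrite mxE !unlift_none. Qed.

Lemma insmx_row i j h b : insmx i j h i (lift j b) = 0.
Proof. by rewrite mxE unlift_none liftK. Qed.

Lemma insmx_col i j h a : insmx i j h (lift i a) j = 0.
Proof. by rewrite mxE unlift_none liftK. Qed.

Lemma insmx_lift i j h a b : insmx i j h (lift i a) (lift j b) = h a b.
Proof. by rewrite mxE !liftK. Qed.

Definition insmxE := (insmx_id, insmx_row, insmx_col, insmx_lift).

Lemma matrix_lift_ext i j (A B : 'M[F]_n.+1) :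
  A i j = B i j -> (forall b, A i (lift j b) = B i (lift j b)) ->
  (forall a, A (lift i a) j = B (lift i a) j) ->
  (forall a b, A (lift i a) (lift j b) = B (lift i a) (lift j b)) -> A = B.
Proof.
move=> e1 e2 e3 e4; apply/matrixP=> a b.
by case: (unliftP i a) => [a'|] ->; case: (unliftP j b) => [b'|] ->.
Qed.

Lemma mulmx_lift (A B : 'M[F]_n.+1) j a b :
  (A *m B) a b = A a j * B j b + \sum_k A a (lift j k) * B (lift j k) b.
Proof. by rewrite mxE (bigD1_ord j). Qed.

Lemma mul_insmx i j k (A B : 'M[F]_n) :
  insmx i j A *m insmx j k B = insmx i k (A *m B).
Proof.
apply: (matrix_lift_ext (i := i) (j := k)) => [|b|a|a b];
  rewrite (mulmx_lift _ _ j) !insmxE.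
- by rewrite mulr1 big1 ?addr0 // => l _; rewrite insmxE mul0r.
- by rewrite mulr0 big1 ?addr0 // => l _; rewrite insmxE mul0r.
- by rewrite mul0r big1 ?addr0 // => l _; rewrite insmx_col mulr0.
- rewrite mul0r add0r mxE; apply: eq_bigr => l _; by rewrite !insmxE.
Qed.

Lemma insmx1 i : insmx i i 1%:M = 1%:M.
Proof.
apply: (matrix_lift_ext (i := i) (j := i)) => [|b|a|a b]; rewrite insmxE !mxE.
- by rewrite eqxx.
- by rewrite (negbTE (neq_lift _ _)).
- by rewrite eq_sym (negbTE (neq_lift _ _)).
- by rewrite (inj_eq lift_inj).
Qed.

Lemma minor_insmx i j h : row' i (col' j (insmx i j h)) = h.
Proof. by apply/matrixP=> a b; rewrite !mxE !liftK. Qed.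

Lemma det_insmx i j h : \det (insmx i j h) = (-1) ^+ (i + j) * \det h.
Proof.
rewrite (expand_det_row _ i) (bigD1_ord j) //= insmxE mul1r big1.
  by rewrite addr0 /cofactor minor_insmx.
by move=> l _; rewrite insmxE mul0r.
Qed.

Lemma unitmx_insmx i j h : (insmx i j h \in unitmx) = (h \in unitmx).
Proof. by rewrite !unitmxE det_insmx unitrMr // unitrX // unitrN1. Qed.

Lemma insmx_minor i (A : 'M[F]_n.+1) :
  (forall b, A i b = (i == b)%:R) -> (forall a, A a i = (a == i)%:R) ->
  insmx i i (row' i (col' i A)) = A.
Proof.
move=> r c; apply: (matrix_lift_ext (i := i) (j := i)) => [|b|a|a b];
  rewrite insmxE ?r ?c ?eqxx //; last by rewrite !mxE.
  by rewrite (negbTE (neq_lift _ _)).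
by rewrite eq_sym (negbTE (neq_lift _ _)).
Qed.

End Insertion.

Lemma insmx_comm n (h : 'M[F]_n) (b' a : 'I_n.+1) (b a' : 'I_n.+2) :
  (b' <= a)%N -> a' = a.+1 :> nat -> b = b' :> nat ->
  insmx b b (insmx a a h) = insmx a' a' (insmx b' b' h).
Proof.
move=> le_ba ea eb.
have e1 : a' = lift b a by apply: val_inj; rewrite /= ea eb /bump le_ba.
have e2 : lift a' b' = b.
  by apply: val_inj; rewrite /= ea eb /bump ltnNge le_ba.
have e3 x : lift a' (lift b' x) = lift b (lift a x).
  by apply: val_inj; rewrite /= ea eb /bump; lia.
apply: (matrix_lift_ext (i := a') (j := a')) => [|y|x|x y]; rewrite [RHS]insmxE.
- by rewrite e1 !insmxE.
- by case: (unliftP b' y) => [z|] ->; rewrite ?e3 ?e2 e1 !insmxE.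
- by case: (unliftP b' x) => [z|] ->; rewrite ?e3 ?e2 e1 !insmxE.
- by case: (unliftP b' x) => [z|] ->; case: (unliftP b' y) => [w|] ->;
    rewrite [RHS]insmxE ?e3 ?e2 !insmxE.
Qed.

(* [D] lists the (0-based) simple roots k, i.e. positions (k+1, k), of the parabolic.
   Unless [D] has no two consecutive elements this is not closed under products. *)
Definition block_upper (D : pred nat) n (A : 'M[F]_n) :=
  forall i k : 'I_n, (k < i)%N -> ~~ ((i == k.+1 :> nat) && D k) -> A i k = 0.

Definition parabolic D n (A : 'M[F]_n) := A \in unitmx /\ block_upper D A.

(** * Products and inverses of block upper triangular matrices *)

Section Parabolic.
Variable n : nat.
Implicit Types (A B X : 'M[F]_n) (D : pred nat).

Lemma block_upper_mul D1 D2 D A B :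
  block_upper D1 A -> block_upper D2 B ->
  (forall k, D1 k.+1 -> D2 k -> False) ->
  (forall k, D1 k || D2 k -> D k) -> block_upper D (A *m B).
Proof.
move=> hA hB nadj sub i k lt_ki nD; rewrite mxE big1 // => l _.
have [lt_li|le_il] := ltnP l i.
  case: (boolP ((i == l.+1 :> nat) && D1 l)) => [/andP[/eqP ei Dl]|/hA->];
    rewrite ?mul0r //.
  have [lt_kl|le_lk] := ltnP k l.
    case: (boolP ((l == k.+1 :> nat) && D2 k)) => [/andP[/eqP el Dk]|/hB->];
      rewrite ?mulr0 //.
    by rewrite el in Dl; case: (nadj k).
  have ekl : k = l :> nat by lia.
  by case/negP: nD; rewrite ei ekl eqxx sub ?Dl.
have lt_kl : (k < l)%N by lia.
case: (boolP ((l == k.+1 :> nat) && D2 k)) => [/andP[/eqP el Dk]|/hB->];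
  rewrite ?mulr0 //.
have ei : i = k.+1 :> nat by lia.
by case/negP: nD; rewrite ei eqxx sub // Dk orbT.
Qed.

Lemma parabolic_mul D1 D2 D A B :
  parabolic D1 A -> parabolic D2 B ->
  (forall k, D1 k.+1 -> D2 k -> False) ->
  (forall k, D1 k || D2 k -> D k) -> parabolic D (A *m B).
Proof.
move=> [uA hA] [uB hB] nadj sub; split; first by rewrite unitmx_mul uA.
exact: block_upper_mul nadj sub.
Qed.

Lemma block_upper_sub D D' A : (forall k, D k -> D' k) ->
  block_upper D A -> block_upper D' A.
Proof.
move=> sub hA i k lt_ki nD; apply: hA => //.
by apply: contra nD => /andP[-> /sub].
Qed.

Lemma parabolic_sub D D' A : (forall k, D k -> D' k) ->
  parabolic D A -> parabolic D' A.
Proof. by move=> sub [uA hA]; split=> //; apply: block_upper_sub hA. Qed.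

Lemma block_upper_scalar D a : block_upper D (a%:M : 'M[F]_n).
Proof. by move=> i k lt_ki _; rewrite mxE -val_eqE gtn_eqF. Qed.

Lemma block_upperD D A B : block_upper D A -> block_upper D B ->
  block_upper D (A + B).
Proof. by move=> hA hB i k lt nD; rewrite mxE hA ?hB ?addr0. Qed.

Lemma parabolic1 D : parabolic D (1%:M : 'M[F]_n).
Proof. by split; [exact: unitmx1 | exact: block_upper_scalar]. Qed.

Lemma parabolic0_upperP A :
  parabolic pred0 A <-> A \in unitmx /\ forall i j : 'I_n, (j < i)%N -> A i j = 0.
Proof.
split=> -[uA hA]; split=> // i j lt; first by apply: hA; rewrite // andbF.
by move=> _; apply: hA.
Qed.

End Parabolic.

(* By Cayley-Hamilton the inverse is a polynomial in the matrix. *)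
Lemma parabolic_inv (D : pred nat) n (A : 'M[F]_n) : (forall k, D k.+1 -> D k -> False) ->
  parabolic D A -> parabolic D (invmx A).
Proof.
move=> nadj [uA hA]; split; first by rewrite unitmx_inv.
case: n A uA hA => [|n] A uA hA; first by case=> [[]].
have hq (q : {poly F}) : block_upper D (horner_mx A q).
  elim/poly_ind: q => [|q c IH].
    by move=> i k _ _; rewrite rmorph0 mxE.
  rewrite rmorphD rmorphM /= horner_mx_X horner_mx_C.
  apply: block_upperD; last exact: block_upper_scalar.
  apply: block_upper_mul IH hA nadj _ => k; by rewrite orbb.
have [q [c e]] : exists q c, char_poly A = q * 'X + c%:P.
  elim/poly_ind: (char_poly A) => [|q c _]; last by exists q, c.
  by exists 0, 0; rewrite mul0r add0r.
have ec : c != 0.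
  have := char_poly_det A; rewrite e coefD coefMX coefC eqxx add0r => ->.
  by rewrite mulf_neq0 ?expf_neq0 ?oppr_eq0 ?oner_eq0 -?unitfE -?unitmxE.
have := Cayley_Hamilton A; rewrite e rmorphD rmorphM /= horner_mx_X horner_mx_C.
move/eqP; rewrite addr_eq0 => /eqP e1.
have -> : invmx A = (- c^-1)%:M *m horner_mx A q.
  apply: (can_inj (mulmxK uA)); rewrite mulVmx // -mulmxA.
  rewrite [horner_mx A q *m A]e1 mulmxN -scalar_mxM mulNr mulVf //.
  by rewrite raddfN opprK.
apply: block_upper_mul (hq q) nadj _; first exact: block_upper_scalar.
by move=> k; rewrite orbb.
Qed.

(** * Transvections and splitting off one simple root *)

Definition transvection n (a b : 'I_n) (t : F) : 'M[F]_n :=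
  1%:M + t *: delta_mx a b.

Section Transvection.
Variable n : nat.
Implicit Types (a b c i k : 'I_n) (X : 'M[F]_n) (D : pred nat).

Lemma transvectionE a b t i k :
  transvection a b t i k = (i == k)%:R + t * ((i == a) && (k == b))%:R.
Proof. by rewrite !mxE. Qed.

Lemma mul_transvection a b t X i k :
  (transvection a b t *m X) i k = X i k + (i == a)%:R * t * X b k.
Proof.
rewrite mulmxDl mul1mx -scalemxAl mxE [X in _ + X]mxE; congr (_ + _).
rewrite mxE (bigD1 b) //= big1 => [|l ne]; last by rewrite mxE (negbTE ne) andbF mul0r.
by rewrite mxE eqxx andbT addr0 mulrCA mulrA.
Qed.

Lemma transvectionVK a b t : a != b ->
  transvection a b t *m transvection a b (- t) = 1%:M.
Proof.
move=> ne; apply/matrixP=> i k; rewrite mul_transvection !transvectionE mxE.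
rewrite [b == a]eq_sym (negbTE ne) /= mulr0 addr0 [b == k]eq_sym mulNr -mulnb natrM.
ring.
Qed.

Lemma unitmx_transvection a b t : a != b -> transvection a b t \in unitmx.
Proof. by move=> ne; case: (mulmx1_unit (transvectionVK t ne)). Qed.

Lemma parabolic_transvection D c c1 t : c1 = c.+1 :> nat -> D c ->
  parabolic D (transvection c1 c t).
Proof.
move=> e Dc; split; first by rewrite unitmx_transvection // -val_eqE /= e; lia.
move=> i k lt nD; rewrite transvectionE -val_eqE gtn_eqF // add0r.
case: (i =P c1) => [ei|]; last by rewrite mulr0.
case: (k =P c) => [ek|]; last by rewrite mulr0.
by case/negP: nD; rewrite ei ek e eqxx.
Qed.

Lemma parabolic_drop D c c1 X : c1 = c.+1 :> nat -> X c1 c = 0 ->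
  parabolic D X -> parabolic (fun m => D m && (m != c :> nat)) X.
Proof.
move=> e e0 [uX hX]; split=> // i k lt nD.
case: (boolP ((i == k.+1 :> nat) && D k)) => [/andP[ei Dk]|/hX->//].
move: nD; rewrite ei Dk /= negbK => /eqP ek.
have -> : k = c by apply: val_inj.
by have -> : i = c1 by apply: val_inj; rewrite /= e -ek; apply/eqP.
Qed.

Lemma parabolic_mul_left D c X L : (forall m, D m -> c != m.+1 :> nat) ->
  parabolic (pred1 (c : nat)) L -> parabolic D X ->
  parabolic (fun m => D m || (m == c :> nat)) (L *m X).
Proof.
move=> nadj hL hX; apply: (parabolic_mul hL hX) => k; last by rewrite orbC.
by move=> /= /eqP ek /nadj; rewrite ek eqxx.
Qed.

Lemma parabolic_eliminate D c c1 X : c1 = c.+1 :> nat -> X c c != 0 ->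
  (forall m, D m -> c != m.+1 :> nat) -> parabolic D X ->
  parabolic (fun m => D m && (m != c :> nat))
    (transvection c1 c (- (X c1 c / X c c)) *m X).
Proof.
move=> e nz nadj hX; set t := - _.
have := parabolic_mul_left nadj (parabolic_transvection t e (D := pred1 _) (eqxx _)) hX.
move=> /(parabolic_drop e) hY; apply: parabolic_sub (hY _).
  by move=> k; case: (_ == _); rewrite /= ?andbF ?orbF.
by rewrite mul_transvection eqxx mul1r /t mulNr divfK // subrr.
Qed.

(** One elimination step on the rows [c] and [c+1]. The factor [L] is trivial elsewhere, which lets
    it arise from a smaller matrix by insertion. *)
Lemma parabolic_levi D (c : nat) X : (forall m, D m -> c != m.+1) ->
  parabolic D X ->
  exists L Y, [/\ X = L *m Y, parabolic (pred1 c) L,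
    forall a, a != c :> nat -> a != c.+1 :> nat ->
      forall b, L a b = (a == b)%:R /\ L b a = (b == a)%:R &
    parabolic (fun m => D m && (m != c)) Y].
Proof.
move=> nadj hX; have [lt_cn|le_nc] := ltnP c.+1 n; last first.
  exists 1%:M, X; split; first by rewrite mul1mx.
  - exact: parabolic1.
  - by move=> a _ _ b; rewrite !mxE.
  - case: hX => uX hX; split=> // i k lt nD; apply: hX => //.
    apply: contra nD => /andP[ei ->]; rewrite ei /=; apply/eqP=> ek.
    by have := ltn_ord i; rewrite (eqP ei) ek ltnNge le_nc.
pose c0 := Ordinal (ltnW lt_cn); pose c1 := Ordinal lt_cn.
have e : c1 = c0.+1 :> nat by [].
have ne : c1 != c0 by rewrite -val_eqE /=; lia.
have [z|nz] := eqVneq (X c0 c0) 0; last first.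
  set t := X c1 c0 / X c0 c0.
  exists (transvection c1 c0 t), (transvection c1 c0 (- t) *m X); split.
  - by rewrite mulmxA transvectionVK // mul1mx.
  - by apply: (parabolic_transvection _ e); rewrite /= eqxx.
  - move=> a n0 n1 b; rewrite !transvectionE -!(inj_eq val_inj) /=.
    by rewrite (negbTE n0) (negbTE n1) !andbF !mulr0 !addr0.
  - exact: (parabolic_eliminate e).
(* With a zero pivot, swapping the two rows moves the zero to position [(c+1, c)]. *)
pose s := tperm c0 c1; have hs i k : perm_mx s i k = (s i == k)%:R :> F by rewrite !mxE.
have hL : parabolic (pred1 c) (perm_mx s : 'M[F]_n).
  split; first exact: unitmx_perm.
  move=> i k lt nD; rewrite hs /s; move: lt nD; case: tpermP => [->|->|_ _] lt nD.
  - by case: eqP => // ek; move: lt; rewrite -ek /=; lia.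
  - by case: eqP => // ek; move: nD; rewrite -ek /= !eqxx.
  - by rewrite -val_eqE gtn_eqF.
exists (perm_mx s), (perm_mx s *m X); split=> //.
- by rewrite mulmxA -perm_mxM tperm2 perm_mx1 mul1mx.
- move=> a n0 n1 b; have ea : s a = a.
    by rewrite /s tpermD // -val_eqE eq_sym.
  rewrite !hs ea; split=> //.
  by rewrite -{1}ea (inj_eq perm_inj).
- have := parabolic_mul_left (c := c0) nadj hL hX.
  move=> /(parabolic_drop e) hY; apply: parabolic_sub (hY _).
    by move=> k; case: (_ == _); rewrite /= ?andbF ?orbF.
  by rewrite -row_permE mxE tpermR.
Qed.

End Transvection.

(** [parabolic (node true c)] is a minimal parabolic and [parabolic (node false c)] is the Borel
    subgroup, so one Boolean covers the letters T and R. *)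
Definition node (t : bool) (c : nat) : pred nat := fun k => t && (k == c).

Lemma node_sep t c k : node t c k.+1 -> node t c k -> False.
Proof. by move=> /andP[_ /eqP<-] /andP[_]; rewrite ltn_eqF. Qed.

(** * Parabolics of single letters under insertion *)

Section InsertParabolic.
Variables (n : nat) (b : 'I_n.+1) (t : bool) (c' c : nat).
Hypotheses (ec : c = bump b c') (nb : t -> b != c'.+1 :> nat).

(** By [nb] the inserted index does not separate [c'] and [c'+1]; these become [c] and [c+1]. *)
Lemma parabolic_insmx (l : 'M[F]_n) :
  parabolic (node t c') l -> parabolic (node t c) (insmx b b l).
Proof.
move=> [ul hl]; split; first by rewrite unitmx_insmx.
move=> i k; case: (unliftP b i) => [i'|] ->; case: (unliftP b k) => [k'|] -> //=.
- move=> lt nD; rewrite insmxE hl //; first by move: lt; rewrite /bump; lia.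
  apply: contra nD => /andP[/eqP ei /andP[ht /eqP ek]].
  rewrite /node ht ec ek /= eqxx andbT ei ek.
  by move: (nb ht); rewrite /bump; lia.
- by rewrite insmxE.
- by rewrite insmxE.
- by rewrite ltnn.
Qed.

Lemma parabolic_minor (l : 'M[F]_n) :
  parabolic (node t c) (insmx b b l) -> parabolic (node t c') l.
Proof.
move=> [ul hl]; split; first by rewrite unitmx_insmx in ul.
move=> i k lt nD; rewrite -(insmx_lift b b l) hl //=.
  by move: lt; rewrite /bump; lia.
apply: contra nD => /andP[/eqP ei /andP[ht /eqP ek]].
have ek' : k = c' :> nat by move: ek; rewrite ec /bump; lia.
rewrite /node ht ek' /= eqxx andbT.
by move: (nb ht) ei; rewrite ek' /bump; lia.
Qed.

End InsertParabolic.

(** For [t] true, [parabolic_levi] splits off the node [c] on the left; its factor has trivial row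
    and column [b] since [b] is neither [c] nor [c+1]. *)
Lemma parabolic_split n (b : 'I_n.+1) (t t2 : bool) c' c e (X : 'M[F]_n.+1) :
  c = bump b c' -> (t -> b != c'.+1 :> nat) -> (t && t2 -> c != e.+1) ->
  parabolic (fun k => node t c k || node t2 e k) X <->
  exists l Y, [/\ X = insmx b b l *m Y, parabolic (node t c') l &
                 parabolic (node t2 e) Y].
Proof.
move=> ec nb nce; split=> [hX|[l [Y [-> hl hY]]]]; last first.
  apply: (parabolic_mul (parabolic_insmx ec nb hl) hY) => // k.
  move=> /andP[ht /eqP ec1] /andP[ht2 /eqP ek].
  by move: nce; rewrite ht ht2 -ec1 ek eqxx => /(_ isT).
case: t nb nce hX => [nbt nce hX|_ _ hX]; last first.
  exists 1%:M, X; rewrite insmx1 mul1mx; split=> //; exact: parabolic1.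
have [|L [Y [-> hL tL hY]]] := parabolic_levi (c := c) _ hX.
  move=> k; rewrite /node /= => /orP[/eqP->|/andP[ht2 /eqP->]]; first by rewrite ltn_eqF.
  exact: nce.
have [n0 n1] : b != c :> nat /\ b != c.+1 :> nat.
  by move: (nbt isT); rewrite ec /bump; lia.
have eL := insmx_minor (fun a => (tL _ n0 n1 a).1) (fun a => (tL _ n0 n1 a).2).
exists (row' b (col' b L)), Y; rewrite eL; split=> //.
  by apply: (parabolic_minor (t := true) ec nbt); rewrite eL.
apply: parabolic_sub hY => k /andP[/orP[|//]].
by rewrite /node /= => ->.
Qed.

(** * The operator of a letter and the commutation relations *)

Definition insert_step n (t : bool) (i : 'I_n.+1) (S : 'M[F]_n -> Prop)
    (g : 'M[F]_n.+1) :=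
  exists h p, [/\ S h, parabolic (node t i) p & g = insmx i i h *m p].

(** Both composites consist of doubly inserted matrices times block upper matrices with nodes [a']
    and [b], a description symmetric in the two letters. If [t1] and [t2] both hold, the bound on
    [b'] makes these nodes non-adjacent. *)
Lemma insert_step_comm n (t1 t2 : bool) (S : 'M[F]_n -> Prop) (b' a : 'I_n.+1)
    (b a' : 'I_n.+2) g :
  (b' + t2 <= a)%N -> a' = a.+1 :> nat -> b = b' :> nat ->
  insert_step t2 b (insert_step t1 a S) g <->
  insert_step t1 a' (insert_step t2 b' S) g.
Proof.
move=> le_ba ea eb; have le : (b' <= a)%N by lia.
have X1 X := @parabolic_split n.+1 b t1 t2 a a' b X.
have X2 X := @parabolic_split n.+1 a' t2 t1 b' b a' X.
have common : insert_step t2 b (insert_step t1 a S) g <->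
  exists h X, [/\ S h, parabolic (fun k => node t1 a' k || node t2 b k) X &
                 g = insmx b b (insmx a a h) *m X].
  split=> [[_ [q [[h [p [Sh hp ->]]] hq ->]]]|[h [X [Sh]]]].
    exists h, (insmx b b p *m q); rewrite mulmxA mul_insmx; split=> //.
    apply/X1; [by rewrite ea eb /bump le | by move=> _; lia | by case/andP=> _; lia|].
    by exists p, q.
  case/X1; [by rewrite ea eb /bump le | by move=> _; lia | by case/andP=> _; lia|].
  move=> l [Y [-> hl hY]] ->; rewrite mulmxA mul_insmx.
  by exists (insmx a a h *m l), Y; split=> //; exists h, l.
apply: (iff_trans common); rewrite (_ : (fun k => _) = (fun k => node t2 b k || node t1 a' k)); last first.
  by apply: functional_extensionality => k; rewrite orbC.
split=> [[h [X [Sh]]]|[_ [q [[h [p [Sh hp ->]]] hq ->]]]].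
  case/X2; [by rewrite ea eb /bump; lia | by lia | by lia|].
  move=> l [Y [-> hl hY]] ->; rewrite (insmx_comm _ le ea eb) mulmxA mul_insmx.
  by exists (insmx b' b' h *m l), Y; split=> //; exists h, l.
exists h, (insmx a' a' p *m q); rewrite (insmx_comm _ le ea eb) mulmxA mul_insmx.
split=> //; apply/X2; [by rewrite ea eb /bump; lia | by lia | by lia|].
by exists p, q.
Qed.

Lemma parabolic0_transvection n (a b : 'I_n) t :
  (a < b)%N -> parabolic pred0 (transvection a b t).
Proof.
move=> lt; split=> [|i k lt' _].
  by rewrite unitmx_transvection // -val_eqE ltn_eqF.
rewrite transvectionE -val_eqE gtn_eqF //; case: eqP => [ei|_]; last by rewrite mulr0 addr0.
case: eqP => [ek|_]; last by rewrite mulr0 addr0.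
by move: lt'; rewrite ei ek; lia.
Qed.

Lemma invmx_mulr n (A T1 T2 : 'M[F]_n) : A \in unitmx -> T1 *m T2 = 1%:M ->
  invmx (A *m T1) = T2 *m invmx A.
Proof.
move=> uA TT; have uX : A *m T1 \in unitmx.
  by rewrite unitmx_mul uA; case: (mulmx1_unit TT).
have e : A *m T1 *m (T2 *m invmx A) = 1%:M.
  by rewrite mulmxA -(mulmxA A) TT mulmx1 mulmxV.
by rewrite -[LHS]mulmx1 -e mulKmx.
Qed.

(** * Factoring a matrix through an inserted one *)

Section Factor.
Variables (n : nat) (t : bool) (j k : 'I_n.+1).
Hypothesis ek : k = (j + t)%N :> nat.

Lemma factor_insmx_pivot (g : 'M[F]_n.+1) : g \in unitmx ->
  (forall b : 'I_n.+1, (b < j)%N -> g ord0 b = 0) ->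
  (forall a : 'I_n.+1, (k < a)%N -> invmx g a ord0 = 0) ->
  invmx g j ord0 != 0 ->
  exists h p, parabolic (node t j) p /\ g = insmx ord0 j h *m p.
Proof.
move=> ug hrow hcol; set c := invmx g => nz.
(* Row [j] is the first row of [g], and column [j] is chosen so that [p] maps the first column of
   [invmx g] to the [j]-th unit vector. *)
pose p : 'M[F]_n.+1 := \matrix_(a, b) match unlift j a, unlift j b with
   | Some a', Some b' => (a' == b')%:R
   | Some a', None => - c a ord0 / c j ord0
   | None, _ => g ord0 b end.
have pj b : p j b = g ord0 b by rewrite mxE unlift_none.
have pl a b : p (lift j a) (lift j b) = (a == b)%:R by rewrite mxE !liftK.
have plj a : p (lift j a) j = - c (lift j a) ord0 / c j ord0.
  by rewrite mxE liftK unlift_none.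
have e : g = insmx ord0 j (row' ord0 (col' j g)) *m p.
  apply: (matrix_lift_ext (i := ord0) (j := j)) => [|b|a|a b];
    rewrite (mulmx_lift _ _ j) insmxE ?mul1r ?mul0r ?add0r.
  - by rewrite pj big1 ?addr0 // => m _; rewrite insmxE mul0r.
  - by rewrite pj big1 ?addr0 // => m _; rewrite insmxE mul0r.
  - have : (g *m c) (lift ord0 a) ord0 = 0 by rewrite mulmxV // mxE.
    rewrite (mulmx_lift _ _ j) => /eqP; rewrite addr_eq0 => /eqP ea.
    apply: (mulIf nz); rewrite ea mulr_suml -sumrN; apply: eq_bigr => m _.
    by rewrite insmxE plj !mxE mulrA divfK // mulrN.
  - rewrite (bigD1 b) //= big1 ?addr0; first by rewrite insmxE pl eqxx mulr1 !mxE.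
    by move=> m ne; rewrite pl (negbTE ne) mulr0.
exists (row' ord0 (col' j g)), p; split=> //; split.
  by move: ug; rewrite {1}e unitmx_mul => /andP[].
move=> a b; case: (unliftP j a) => [a'|] ->; last by move=> lt _; rewrite pj hrow.
case: (unliftP j b) => [b'|] -> lt nD.
  by rewrite pl; case: eqP lt => // ->; rewrite ltnn.
rewrite plj hcol ?oppr0 ?mul0r // ek; move: nD lt; rewrite /node eqxx andbT.
by case: (t); rewrite ?andbT ?andbF; lia.
Qed.

(** If the pivot [invmx g j ord0] is zero, the first row of [g] times the first column of its
    inverse can only equal 1 when [k = j+1] and the entry at [k] is nonzero. A column operation on
    [g] then adds this entry to the pivot. *)
Lemma factor_insmx (g : 'M[F]_n.+1) : g \in unitmx ->
  (forall b : 'I_n.+1, (b < j)%N -> g ord0 b = 0) ->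
  (forall a : 'I_n.+1, (k < a)%N -> invmx g a ord0 = 0) ->
  exists h p, parabolic (node t j) p /\ g = insmx ord0 j h *m p.
Proof.
move=> ug hrow hcol.
have [z|] := eqVneq (invmx g j ord0) 0; last exact: factor_insmx_pivot.
have : (g *m invmx g) ord0 ord0 = 1 by rewrite mulmxV // mxE.
rewrite mxE (bigD1 j) //= z mulr0 add0r => s1.
have nk : k != j.
  apply/eqP=> ekj; move/eqP: s1; rewrite big1 ?[0 == 1]eq_sym ?oner_eq0 // => m ne.
  have [lt|] := ltnP m j; first by rewrite hrow ?mul0r.
  by rewrite leq_eqVlt eq_sym val_eqE (negbTE ne) /= -ekj => /hcol->; rewrite mulr0.
have lt_jk : (j < k)%N by move: nk; rewrite -val_eqE /= ek; lia.
have ckn : invmx g k ord0 != 0.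
  apply: contraTneq (oner_neq0 F) => zk; rewrite -s1 negbK big1 // => m ne.
  have [lt|] := ltnP m j; first by rewrite hrow ?mul0r.
  rewrite leq_eqVlt eq_sym val_eqE (negbTE ne) /= => lt.
  have [le|/hcol->] := leqP m k; last by rewrite mulr0.
  have -> : m = k by apply: val_inj; rewrite /= ek in le *; case: (t) le => /=; lia.
  by rewrite zk mulr0.
have njk : j != k by rewrite eq_sym.
(* Passing to [g *m T1] adds row [k] of [invmx g] to its row [j] and changes only column [k] of [g],
   so the zeros of the first row before [j] survive. *)
have TT := transvectionVK (-1 : F) njk; rewrite opprK in TT.
set T1 := transvection j k (-1) in TT; set T2 := transvection j k 1 in TT.
have uT1 : T1 \in unitmx by apply: unitmx_transvection.
have uG : g *m T1 \in unitmx by rewrite unitmx_mul ug.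
have invT := invmx_mulr ug TT.
have [||||h [p [hp e]]] := @factor_insmx_pivot (g *m T1).
- by rewrite unitmx_mul ug.
- move=> b lt; rewrite mxE (bigD1 b) //= hrow // mul0r add0r big1 // => m ne.
  rewrite transvectionE (negbTE ne) -[b == k]val_eqE ltn_eqF ?andbF ?mulr0 ?addr0 ?mulr0 //.
  exact: ltn_trans lt lt_jk.
- move=> a lt; rewrite invT mul_transvection hcol // -val_eqE gtn_eqF ?mul0r ?addr0 //.
  exact: ltn_trans lt_jk lt.
- by rewrite invT mul_transvection eqxx z !mul1r add0r.
exists h, (p *m T2); rewrite mulmxA -e -mulmxA TT mulmx1; split=> //.
have hT2 := parabolic0_transvection 1 lt_jk.
by apply: (parabolic_mul hp hT2) => // m; rewrite orbF.
Qed.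

End Factor.

End BlockUpper.

(** * Polynomial functions and Zariski closures *)

Section Closure.
Variable R : realType.
Local Notation C := (R[i]).

Lemma polyfun_ext n (f g : 'M[C]_n -> C) : f =1 g -> polyfun f -> polyfun g.
Proof. by move=> e; rewrite (functional_extensionality _ _ e). Qed.

Lemma polyfun_sum n I (r : seq I) (P : pred I) (f : I -> 'M[C]_n -> C) :
  (forall i, polyfun (f i)) -> polyfun (fun A => \sum_(i <- r | P i) f i A).
Proof.
move=> hf; elim: r => [|i r IH].
  by apply: polyfun_ext (pf_cst _ 0) => A; rewrite big_nil.
have [Pi|nPi] := boolP (P i); last first.
  by apply: polyfun_ext IH => A; rewrite big_cons (negbTE nPi).
by apply: polyfun_ext (pf_add (hf i) IH) => A; rewrite big_cons Pi.
Qed.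

Lemma polyfun_prod n I (r : seq I) (P : pred I) (f : I -> 'M[C]_n -> C) :
  (forall i, polyfun (f i)) -> polyfun (fun A => \prod_(i <- r | P i) f i A).
Proof.
move=> hf; elim: r => [|i r IH].
  by apply: polyfun_ext (pf_cst _ 1) => A; rewrite big_nil.
have [Pi|nPi] := boolP (P i); last first.
  by apply: polyfun_ext IH => A; rewrite big_cons (negbTE nPi).
by apply: polyfun_ext (pf_mul (hf i) IH) => A; rewrite big_cons Pi.
Qed.

Lemma polyfun_det n : polyfun (fun A : 'M[C]_n => \det A).
Proof.
apply: polyfun_sum => s; apply: pf_mul; first exact: pf_cst.
by apply: polyfun_prod => i; apply: pf_coord.
Qed.

Definition polymap m n (phi : 'M[C]_m -> 'M[C]_n) :=
  forall i j, polyfun (fun A => phi A i j).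

Lemma polyfun_comp m n (phi : 'M[C]_m -> 'M[C]_n) f :
  polymap phi -> polyfun f -> polyfun (fun A => f (phi A)).
Proof.
move=> hphi; elim=> [c|i j|f1 f2 _ h1 _ h2|f1 f2 _ h1 _ h2].
- exact: pf_cst.
- exact: hphi.
- exact: pf_add h1 h2.
- exact: pf_mul h1 h2.
Qed.

Lemma polymap_mull n (B : 'M[C]_n) : polymap (mulmx B).
Proof.
move=> i j; apply: (@polyfun_ext _ (fun A => \sum_k B i k * A k j)) => [A|].
  by rewrite mxE.
apply: polyfun_sum => k; apply: pf_mul; [exact: pf_cst | exact: pf_coord].
Qed.

Lemma polymap_mulr n (B : 'M[C]_n) : polymap (mulmx^~ B).
Proof.
move=> i j; apply: (@polyfun_ext _ (fun A => \sum_k A i k * B k j)) => [A|].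
  by rewrite mxE.
apply: polyfun_sum => k; apply: pf_mul; [exact: pf_coord | exact: pf_cst].
Qed.

Lemma polymap_minor n (i j : 'I_n.+1) :
  polymap (fun A : 'M[C]_n.+1 => row' i (col' j A)).
Proof.
move=> a b; apply: (@polyfun_ext _ (fun A => A (lift i a) (lift j b))) => [A|].
  by rewrite !mxE.
exact: pf_coord.
Qed.

Lemma polymap_insmx n (i j : 'I_n.+1) : polymap (@insmx C n i j).
Proof.
move=> a b; case: (unliftP i a) => [a'|] ->; case: (unliftP j b) => [b'|] ->.
- apply: (@polyfun_ext _ (fun A => A a' b')) => [A|]; first by rewrite insmxE.
  exact: pf_coord.
- apply: (@polyfun_ext _ (fun=> 0)) => [A|]; first by rewrite insmxE.
  exact: pf_cst.
- apply: (@polyfun_ext _ (fun=> 0)) => [A|]; first by rewrite insmxE.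
  exact: pf_cst.
- apply: (@polyfun_ext _ (fun=> 1)) => [A|]; first by rewrite insmxE.
  exact: pf_cst.
Qed.

(* The Schur complement of the entry (i, j), multiplied by that entry so that it
   is polynomial. *)
Definition schur n (i j : 'I_n.+1) (A : 'M[C]_n.+1) : 'M[C]_n :=
  \matrix_(a, b) (A i j * A (lift i a) (lift j b) -
                  A (lift i a) j * A i (lift j b)).

Lemma polymap_schur n (i j : 'I_n.+1) : polymap (@schur n i j).
Proof.
move=> a b; apply: (@polyfun_ext _ (fun A => A i j * A (lift i a) (lift j b) +
                  (-1) * (A (lift i a) j * A i (lift j b)))) => [A|].
  by rewrite mxE mulN1r.
apply: pf_add; first by apply: pf_mul; apply: pf_coord.
by apply: pf_mul; [exact: pf_cst | apply: pf_mul; apply: pf_coord].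
Qed.

Lemma polyfun_line n (f : 'M[C]_n -> C) (A : 'M[C]_n) : polyfun f ->
  exists q : {poly C}, forall x, q.[x] = f (A + x%:M).
Proof.
elim=> [c|i j|f1 f2 _ [q1 h1] _ [q2 h2]|f1 f2 _ [q1 h1] _ [q2 h2]].
- by exists c%:P => x; rewrite hornerC.
- exists ((A i j)%:P + (i == j)%:R *: 'X) => x; rewrite !hornerE !mxE.
  by rewrite mulr_natl.
- by exists (q1 + q2) => x; rewrite hornerD h1 h2.
- by exists (q1 * q2) => x; rewrite hornerM h1 h2.
Qed.

Lemma poly_eq0_horner (q : {poly C}) : (forall x, q.[x] = 0) -> q = 0.
Proof.
move=> h; apply/eqP/negPn/negP => nz.
pose rs := [seq k%:R : C | k <- iota 0 (size q)].
have rs_root : all (root q) rs by apply/allP=> x _; apply/eqP.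
have rs_uniq : uniq rs.
  by rewrite map_inj_uniq ?iota_uniq // => a b /eqP; rewrite eqr_nat => /eqP.
by have := max_poly_roots nz rs_root rs_uniq; rewrite size_map size_iota ltnn.
Qed.

Section ZClosure.
Variables m n : nat.
Implicit Types (S : 'M[C]_m -> Prop) (T : 'M[C]_n -> Prop).

Lemma zclosure_incl S g : S g -> zclosure S g.
Proof. by move=> Sg f _; apply. Qed.

(** Multiplying the test function by the determinant makes it vanish also at points of [S] with
    singular image; at [g] the determinant cancels. *)
Lemma zclosure_map_unit (phi : 'M[C]_m -> 'M[C]_n) S T g : polymap phi ->
  (forall h, S h -> phi h \in unitmx -> zclosure T (phi h)) ->
  zclosure S g -> phi g \in unitmx -> zclosure T (phi g).
Proof.
move=> hphi hST hg ug f pf fT.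
have p0 := pf_mul (polyfun_comp hphi (polyfun_det n)) (polyfun_comp hphi pf).
have /eqP : \det (phi g) * f (phi g) = 0.
  apply: (hg _ p0) => h Sh.
  have [u|nu] := boolP (phi h \in unitmx); first by rewrite (hST h Sh u f pf fT) mulr0.
  by move: nu; rewrite unitmxE unitfE negbK => /eqP->; rewrite mul0r.
by rewrite mulf_eq0 => /orP[|/eqP//]; move: ug; rewrite unitmxE unitfE => /negbTE->.
Qed.

Lemma zclosure_map (phi : 'M[C]_m -> 'M[C]_n) S T g : polymap phi ->
  (forall h, S h -> zclosure T (phi h)) -> zclosure S g -> zclosure T (phi g).
Proof.
move=> hphi hST hg f pf fT; apply: (hg _ (polyfun_comp hphi pf)) => h Sh.
exact: hST.
Qed.

(** The test function along the line, times [d], vanishes identically; so the former is the zero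
    polynomial, and [x = 0] gives the claim. *)
Lemma zclosure_line S p (d : {poly C}) : d != 0 ->
  (forall x, d.[x] != 0 -> S (p + x%:M)) -> zclosure S p.
Proof.
move=> nz hd f pf fS; have [q hq] := polyfun_line p pf.
have /eqP : q * d = 0.
  apply: poly_eq0_horner => x; rewrite hornerM hq.
  by have [->|/hd/fS->] := eqVneq d.[x] 0; rewrite ?mulr0 ?mul0r.
rewrite mulf_eq0 (negbTE nz) orbF => /eqP q0.
have := hq 0; rewrite q0 horner0 => ->.
by congr f; apply/matrixP=> a b; rewrite !mxE mul0rn addr0.
Qed.

End ZClosure.

(** * Cells and their stability under parabolics *)

Section Cell.
Variable n : nat.
Implicit Types (Q : 'M[C]_n -> Prop) (w : 'S_n).

Lemma upperB_parabolic (b : 'M[C]_n) : upperB b <-> parabolic pred0 b.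
Proof. by split=> /parabolic0_upperP. Qed.

Lemma upperB_mul (a b : 'M[C]_n) : upperB a -> upperB b -> upperB (a *m b).
Proof.
move=> /upperB_parabolic ha /upperB_parabolic hb; apply/upperB_parabolic.
exact: (parabolic_mul ha hb).
Qed.

Lemma lowerB_mul (a b : 'M[C]_n) : lowerB a -> lowerB b -> lowerB (a *m b).
Proof.
move=> [ua ha] [ub hb]; split=> [|i k lt]; first by rewrite unitmx_mul ua.
rewrite mxE big1 // => l _; have [lt_il|le_li] := ltnP i l.
  by rewrite ha ?mul0r.
by rewrite hb ?mulr0 // (leq_ltn_trans le_li).
Qed.

Lemma upperB_transvection (a b : 'I_n) t : (a < b)%N -> upperB (transvection a b (t : C)).
Proof. by move=> lt; apply/upperB_parabolic/parabolic0_transvection. Qed.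

Lemma lowerB_transvection (a b : 'I_n) t : (b < a)%N -> lowerB (transvection a b (t : C)).
Proof.
move=> lt; split=> [|i k lt'].
  by rewrite unitmx_transvection // -val_eqE gtn_eqF.
rewrite transvectionE -val_eqE ltn_eqF //; case: eqP => [ei|_]; last by rewrite mulr0 addr0.
case: eqP => [ek|_]; last by rewrite mulr0 addr0.
by move: lt'; rewrite ei ek; lia.
Qed.

Lemma pmat_transvection w (a b : 'I_n) t :
  pmat R w *m transvection a b t = transvection (w a) (w b) t *m pmat R w.
Proof.
rewrite mulmxDr mulmxDl mulmx1 mul1mx -scalemxAr -scalemxAl; congr (_ + _ *: _).
transitivity (delta_mx (w a) b : 'M[C]_n); apply/matrixP=> x y; rewrite !mxE.
  rewrite (bigD1 a) //= big1 => [|l nl].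
    by rewrite !mxE eqxx addr0 [x == _]eq_sym; case: (_ == x); rewrite ?mul1r ?mul0r.
  by rewrite !mxE (negbTE nl) mulr0.
rewrite (bigD1 (w b)) //= big1 => [|l nl].
  by rewrite !mxE eqxx andbT addr0 (inj_eq perm_inj) [y == _]eq_sym; case: (x == _); rewrite ?mul1r ?mul0r.
by rewrite !mxE (negbTE nl) andbF mul0r.
Qed.

(** Taking [Q] to be [upperB] or [lowerB] gives the sets closed in [schubert] and [opp_schubert], so
    both are treated at once. *)
Definition cell Q w (h : 'M[C]_n) : Prop :=
  exists b1 b2, Q b1 /\ upperB b2 /\ h = b1 *m pmat R w *m b2.

(* A generic element of the parabolic factors as a lower transvection times an
   upper triangular matrix, and the hypothesis moves the transvection across [w]
   into [Q]; the remaining elements are limits along [p + x%:M]. *)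
Lemma zclosure_cell_parabolic Q w (t : bool) (j : 'I_n) x p :
  (t -> exists2 j1 : 'I_n, j1 = j.+1 :> nat &
    forall b s, Q b -> Q (b *m transvection (w j1) (w j) s)) ->
  zclosure (cell Q w) x -> parabolic (node t j) p ->
  zclosure (cell Q w) (x *m p).
Proof.
move=> ht hx hp; apply: (zclosure_map (@polymap_mulr _ p) _ hx) => _ [b1 [b2 [Qb [ub ->]]]].
case: t ht hp => [/(_ isT) [j1 ej hQ] hp|_ hp]; last first.
  apply: zclosure_incl; exists b1, (b2 *m p); split=> //; split; last by rewrite !mulmxA.
  by apply: upperB_mul => //; apply/upperB_parabolic.
rewrite -mulmxA.
have : parabolic (node true j) (b2 *m p).
  by apply: (parabolic_mul (iffLR (upperB_parabolic b2) ub) hp).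
move: (b2 *m p) => {x hx hp ub b2} q [uq hq].
have [d hd] := polyfun_line q (polyfun_det n).
have hX : zclosure (fun A => parabolic (node true j) A /\ A j j != 0) q.
  (* [d] is the determinant along the line and the second factor is the pivot at [(j, j)]. *)
  apply: (@zclosure_line _ _ _ (d * ((q j j)%:P + 'X))) => [|y].
    rewrite mulf_neq0 //; last by rewrite addrC -size_poly_eq0 size_XaddC.
    apply/eqP=> d0; have := hd 0; rewrite d0 horner0 => /esym/eqP.
    rewrite (_ : q + 0%:M = q) => [/eqP e0|].
      by move: uq; rewrite unitmxE unitfE e0 eqxx.
    by apply/matrixP=> a b; rewrite !mxE mul0rn addr0.
  rewrite hornerM mulf_eq0 negb_or hd !hornerE => /andP[uy nz]; split.
    split; first by rewrite unitmxE unitfE.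
    by apply: block_upperD hq _; apply: block_upper_scalar.
  by rewrite !mxE eqxx.
apply: (zclosure_map (@polymap_mull _ (b1 *m pmat R w)) _ hX) => A [hA nz].
apply: zclosure_incl; set s := A j1 j / A j j.
exists (b1 *m transvection (w j1) (w j) s), (transvection j1 j (- s) *m A).
split; first exact: hQ.
split.
  apply/upperB_parabolic; apply: parabolic_sub (parabolic_eliminate ej nz _ hA).
    by move=> k /andP[/andP[_ ->]].
  by move=> k /andP[_ /eqP->]; rewrite ltn_eqF.
rewrite -!mulmxA; congr (_ *m _); rewrite !mulmxA -pmat_transvection -!mulmxA.
by rewrite (mulmxA (transvection _ _ _)) transvectionVK ?mul1mx // -val_eqE /= ej gtn_eqF.
Qed.

End Cell.
End Closure.

(** * Recursion for Richardson varieties *)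

Section Richardson.
Variable R : realType.
Local Notation C := (R[i]).

Lemma pmat1 n : pmat R (1 : 'S_n)%g = 1%:M.
Proof. by apply/matrixP=> a b; rewrite !mxE perm1 eq_sym. Qed.

Lemma pmatM n (w v : 'S_n) : pmat R w *m pmat R v = pmat R (v * w)%g.
Proof.
apply/matrixP=> a b; rewrite !mxE (bigD1 (v b)) //= big1 => [|l ne].
  by rewrite !mxE eqxx mulr1 addr0 permM.
by rewrite !mxE [v b == l]eq_sym (negbTE ne) mulr0.
Qed.

Lemma pmatVr n (w : 'S_n) : pmat R w *m pmat R w^-1 = 1%:M.
Proof. by rewrite pmatM mulVg pmat1. Qed.

Section RichardsonStep.
Variable n : nat.
Local Notation M := 'M[C]_n.
Local Notation M' := 'M[C]_n.+1.

Lemma pmat_lift_perm (i j : 'I_n.+1) (w : 'S_n) :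
  pmat R (lift_perm j i w) = insmx i j (pmat R w).
Proof.
apply: (matrix_lift_ext (i := i) (j := j)) => [|b|a|a b]; rewrite insmxE !mxE.
- by rewrite lift_perm_id eqxx.
- by rewrite lift_perm_lift eq_sym (negbTE (neq_lift _ _)).
- by rewrite lift_perm_id (negbTE (neq_lift _ _)).
- by rewrite lift_perm_lift (inj_eq lift_inj).
Qed.

Lemma minor_mul (i l j : 'I_n.+1) (A B : M') :
  (forall a, A (lift i a) l = 0) \/ (forall b, B l (lift j b) = 0) ->
  row' i (col' j (A *m B)) = row' i (col' l A) *m row' l (col' j B).
Proof.
move=> h; apply/matrixP=> a b; rewrite !mxE (bigD1_ord l) //=.
rewrite (_ : _ * _ = 0) ?add0r; first by apply: eq_bigr => k _; rewrite !mxE.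
by case: h => ->; rewrite ?mul0r ?mulr0.
Qed.

(** Row [i] of [A *m B] is a multiple of row [l] of [B], so the terms through column [l] of [A]
    cancel in the Schur complement. *)
Lemma schur_mul (i l j : 'I_n.+1) (A B : M') :
  (forall b, A i (lift l b) = 0) ->
  schur i j (A *m B) = A i l *: (row' i (col' l A) *m schur l j B).
Proof.
move=> h; have hi c : (A *m B) i c = A i l * B l c.
  by rewrite (mulmx_lift _ _ l) big1 ?addr0 // => k _; rewrite h mul0r.
apply/matrixP=> a b; rewrite mxE !hi !(mulmx_lift A B l (lift i a)).
rewrite [RHS]mxE [X in _ = _ * X]mxE.
have -> : \sum_k (row' i (col' l A)) a k * schur l j B k b =
  B l j * (\sum_k A (lift i a) (lift l k) * B (lift l k) (lift j b))
   - (\sum_k A (lift i a) (lift l k) * B (lift l k) j) * B l (lift j b).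
  by rewrite mulr_sumr mulr_suml -sumrB; apply: eq_bigr => k _; rewrite !mxE; ring.
ring.
Qed.

Lemma schur_insmx (i j : 'I_n.+1) (h : M) : schur i j (insmx i j h) = h.
Proof.
by apply/matrixP=> a b; rewrite mxE insmx_id insmx_row insmx_lift mul1r mulr0 subr0.
Qed.

Lemma insmx0_mul3 (i j k : 'I_n.+1) (A B D : M) :
  insmx i j (A *m B *m D) = insmx i ord0 A *m insmx ord0 k B *m insmx k j D.
Proof. by rewrite !mul_insmx. Qed.

Lemma upperB_insmx0 (b : M) : upperB b -> upperB (insmx ord0 ord0 b).
Proof.
move=> [ub hb]; split=> [|i k]; first by rewrite unitmx_insmx.
case: (unliftP ord0 i) => [i'|] -> //; case: (unliftP ord0 k) => [k'|] -> lt.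
  by rewrite insmxE hb.
by rewrite insmxE.
Qed.

Lemma lowerB_insmx0 (b : M) : lowerB b -> lowerB (insmx ord0 ord0 b).
Proof.
move=> [ub hb]; split=> [|i k]; first by rewrite unitmx_insmx.
case: (unliftP ord0 k) => [k'|] -> //; case: (unliftP ord0 i) => [i'|] -> lt.
  by rewrite insmxE hb.
by rewrite insmxE.
Qed.

Section Step.
Variables (t : bool) (j k : 'I_n.+1).
Hypothesis ek : k = (j + t)%N :> nat.

(** For [t] true the inserted 1 lies at [(j+1, j)], the one subdiagonal position that the node
    allows. *)
Lemma parabolic_insmx_shift (b : M) : upperB b -> parabolic (node t j) (insmx k j b).
Proof.
move=> [ub hb]; split=> [|x y]; first by rewrite unitmx_insmx.
case: (unliftP k x) => [x'|] ->; case: (unliftP j y) => [y'|] -> lt nD;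
  rewrite insmxE //.
  by apply: hb; move: lt; rewrite /= /bump ek; case: (t); lia.
by case/negP: nD; move: lt; rewrite /node eqxx ek; case: (t); rewrite ?addn0 ?ltnn // addn1 eqxx.
Qed.

Lemma upper_minor_shift (b : M') : upperB b ->
  forall x y : 'I_n, (y < x)%N -> (row' k (col' j b)) x y = 0.
Proof.
move=> [_ hb] x y lt; rewrite !mxE; apply: hb.
by rewrite /= /bump ek; case: (t); lia.
Qed.

(** For [t] true the permutation has a descent at [j], as its value at [k = j+1] is 0; hence the
    transvection moved across it is upper triangular. *)
Lemma parabolic_schubert (v : 'S_n) g p : parabolic (node t j) p ->
  zclosure (cell (@upperB R n.+1) (lift_perm k ord0 v)) g ->
  zclosure (cell (@upperB R n.+1) (lift_perm k ord0 v)) (g *m p).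
Proof.
move=> hp hg; apply: zclosure_cell_parabolic hg hp => ht.
exists k => [|b s ub]; first by rewrite ek ht addn1.
apply: upperB_mul => //; apply: upperB_transvection; rewrite lift_perm_id.
have : j != k by rewrite -val_eqE /= ek ht; lia.
by case: (unliftP k j) => [j' ->|->]; rewrite ?eqxx // lift_perm_lift.
Qed.

(** The right factor [b2] becomes [insmx k j b2], which is in general only parabolic; stability of
    the closure absorbs it. *)
Lemma schubert_insmx (v : 'S_n) h :
  zclosure (cell (@upperB R n) v) h ->
  zclosure (cell (@upperB R n.+1) (lift_perm k ord0 v)) (insmx ord0 j h).
Proof.
apply: zclosure_map; first exact: polymap_insmx.
move=> _ [b1 [b2 [u1 [u2 ->]]]]; rewrite (insmx0_mul3 _ _ k) -pmat_lift_perm.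
apply: parabolic_schubert; first exact: parabolic_insmx_shift.
apply: zclosure_incl; exists (insmx ord0 ord0 b1), 1%:M; rewrite mulmx1.
split; first exact: upperB_insmx0.
by split=> //; apply/upperB_parabolic; apply: parabolic1.
Qed.

(** The first column of [b1] is zero below the corner, so the minor of the product is a product of
    minors, each invertible when the product is. *)
Lemma schubert_minor (v : 'S_n) g :
  zclosure (cell (@upperB R n.+1) (lift_perm k ord0 v)) g ->
  row' ord0 (col' j g) \in unitmx ->
  zclosure (cell (@upperB R n) v) (row' ord0 (col' j g)).
Proof.
move=> hg ug; refine (zclosure_map_unit (polymap_minor R ord0 j) _ hg ug).
move=> {hg ug} _ [b1 [b2 [[u1 h1] [hb2 ->]]]].
rewrite -mulmxA (minor_mul (l := ord0)); last by left=> a; apply: h1.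
rewrite pmat_lift_perm (minor_mul (l := k)); last by left=> a; rewrite insmxE.
rewrite minor_insmx !unitmx_mul => /and3P[w1 w2 w3].
apply: zclosure_incl; exists (row' ord0 (col' ord0 b1)), (row' k (col' j b2)).
rewrite mulmxA; split; last split=> //.
  by split=> // x y lt; rewrite !mxE; apply: h1.
by split=> //; apply: upper_minor_shift.
Qed.

(** The adjugate replaces the inverse because its entries are polynomial. On the cell, [invmx b1]
    preserves the line of the first unit vector, the inverse permutation takes it to position [k],
    and [invmx b2] creates no entry after [k]. *)
Lemma schubert_adj (v : 'S_n) g :
  zclosure (cell (@upperB R n.+1) (lift_perm k ord0 v)) g ->
  forall a : 'I_n.+1, (k < a)%N -> (\adj g) a ord0 = 0.
Proof.
move=> hg a lt; apply: (hg (fun g => (\adj g) a ord0)).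
  apply: (@polyfun_ext _ _ (fun g => (-1) ^+ (@ord0 n + a)%N * \det (row' ord0 (col' a g)))).
    by move=> A; rewrite mxE.
  apply: pf_mul; first exact: pf_cst.
  exact: (polyfun_comp (polymap_minor R _ _) (@polyfun_det _ _)).
move=> _ [b1 [b2 [/upperB_parabolic h1 [/upperB_parabolic h2 ->]]]].
have nadj c : pred0 c.+1 -> @pred0 nat c -> False by [].
have [_ i1] := parabolic_inv nadj h1; have [_ i2] := parabolic_inv nadj h2.
rewrite pmat_lift_perm; set g0 := _ *m b2.
set Y := invmx b2 *m (insmx k ord0 (pmat R v^-1) *m invmx b1).
have gY : g0 *m Y = 1%:M.
  rewrite /Y /g0 !mulmxA mulmxK ?h2.1 // -(mulmxA b1) mul_insmx pmatVr insmx1.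
  by rewrite mulmx1 mulmxV ?h1.1.
rewrite -[\adj g0]mulmx1 -gY mulmxA mul_adj_mx mul_scalar_mx mxE.
rewrite mxE big1 ?mulr0 // => l _; rewrite (mulmx_lift _ _ ord0) big1 => [|m _].
  case: (unliftP k l) => [l'|] ->; first by rewrite insmxE mul0r addr0 mulr0.
  by rewrite i2 ?mul0r // andbF.
by rewrite i1 ?mulr0 // andbF.
Qed.

(** Here the value 0 is taken at [j], so for [t] true there is an ascent at [j] and the transvection
    is lower triangular. *)
Lemma parabolic_opp_schubert (u : 'S_n) g p : parabolic (node t j) p ->
  zclosure (cell (@lowerB R n.+1) (lift_perm j ord0 u)) g ->
  zclosure (cell (@lowerB R n.+1) (lift_perm j ord0 u)) (g *m p).
Proof.
move=> hp hg; apply: zclosure_cell_parabolic hg hp => ht.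
exists k => [|b s ub]; first by rewrite ek ht addn1.
apply: lowerB_mul => //; apply: lowerB_transvection; rewrite lift_perm_id.
have : k != j by rewrite -val_eqE /= ek ht; lia.
by case: (unliftP j k) => [j' ->|->]; rewrite ?eqxx // lift_perm_lift.
Qed.

Lemma opp_schubert_insmx (u : 'S_n) h :
  zclosure (cell (@lowerB R n) u) h ->
  zclosure (cell (@lowerB R n.+1) (lift_perm j ord0 u)) (insmx ord0 j h).
Proof.
apply: zclosure_map; first exact: polymap_insmx.
move=> _ [b1 [b2 [u1 [u2 ->]]]]; rewrite (insmx0_mul3 _ _ j) -pmat_lift_perm.
apply: zclosure_incl; exists (insmx ord0 ord0 b1), (insmx j j b2).
split; first exact: lowerB_insmx0.
split=> //; apply/upperB_parabolic; have /upperB_parabolic h2 := u2.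
apply: (parabolic_sub (D := node false (bump j j))) => //.
by apply: (parabolic_insmx erefl) => //; apply: parabolic_sub h2.
Qed.

(** Only the first row of a lower triangular [b1] is concentrated at the corner, so deletion need
    not be multiplicative. The Schur complement is, up to the scalar [b1 ord0 ord0], which the left
    factor absorbs. *)
Lemma opp_schubert_schur (u : 'S_n) g :
  zclosure (cell (@lowerB R n.+1) (lift_perm j ord0 u)) g ->
  schur ord0 j g \in unitmx ->
  zclosure (cell (@lowerB R n) u) (schur ord0 j g).
Proof.
move=> hg ug; refine (zclosure_map_unit (@polymap_schur R n ord0 j) _ hg ug).
move=> {hg ug} _ [b1 [b2 [[u1 h1] [[u2 h2] ->]]]].
rewrite -mulmxA (schur_mul (l := ord0)); last by move=> b; apply: h1.
rewrite pmat_lift_perm (schur_mul (l := j)); last by move=> b; rewrite insmxE.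
rewrite minor_insmx insmx_id scale1r scalemxAl !unitmx_mul => /and3P[w1 w2 w3].
apply: zclosure_incl; exists (b1 ord0 ord0 *: row' ord0 (col' ord0 b1)), (schur j j b2).
rewrite mulmxA; split; last split=> //.
  by split=> // x y lt; rewrite !mxE [b1 (lift _ _) _]h1 ?mulr0.
split=> // x y lt; rewrite mxE [b2 (lift j x) (lift j y)]h2.
  (* Upper triangularity kills the factor in column [j] if [j <= y], and the factor in row [j] if
     [y < j]. *)
  have [le_jy|lt_yj] := leqP j y.
    by rewrite mulr0 [b2 (lift j x) j]h2 ?mul0r ?subr0 //= /bump; lia.
  by rewrite mulr0 [b2 j (lift j y)]h2 ?mulr0 ?subr0 //= /bump; lia.
by rewrite /= /bump; lia.
Qed.

Lemma opp_schubert_row0 (u : 'S_n) g :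
  zclosure (cell (@lowerB R n.+1) (lift_perm j ord0 u)) g ->
  forall b : 'I_n.+1, (b < j)%N -> g ord0 b = 0.
Proof.
move=> hg b lt; apply: (hg (fun A => A ord0 b)); first exact: pf_coord.
move=> _ [b1 [b2 [[u1 h1] [[u2 h2] ->]]]].
rewrite -mulmxA (mulmx_lift _ _ ord0) big1 => [|m _]; last by rewrite h1 ?mul0r.
rewrite pmat_lift_perm (mulmx_lift _ _ j) big1 => [|m _].
  by rewrite h2 // !mulr0 !addr0 mulr0.
by rewrite insmxE mul0r.
Qed.

(** The vanishing conditions feed [factor_insmx]. Both closures are stable under [invmx p], so they
    contain the inserted matrix itself, whose minor and Schur complement are both [h]. *)
Lemma richardson_lift_perm (v u : 'S_n) (g : M') :
  richardson (lift_perm k ord0 v) (lift_perm j ord0 u) g <->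
  exists h p, [/\ richardson v u h, parabolic (node t j) p &
                 g = insmx ord0 j h *m p].
Proof.
split=> [[[ug hv] [_ hu]]|[h [p [[[uh hv] [_ hu]] hp ->]]]]; last first.
  have ug : insmx ord0 j h *m p \in unitmx.
    by rewrite unitmx_mul unitmx_insmx uh hp.1.
  by split; split=> //; [apply/parabolic_schubert/schubert_insmx
    | apply/parabolic_opp_schubert/opp_schubert_insmx].
have hcol (a : 'I_n.+1) : (k < a)%N -> invmx g a ord0 = 0.
  by move=> lt; rewrite /invmx ug mxE (schubert_adj hv) ?mulr0.
have [h [p [hp e]]] := factor_insmx ek ug (opp_schubert_row0 hu) hcol.
have uh : h \in unitmx by move: ug; rewrite e unitmx_mul unitmx_insmx => /andP[].
have ei : g *m invmx p = insmx ord0 j h by rewrite e mulmxK ?hp.1.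
have hpi := parabolic_inv (@node_sep t j) hp.
exists h, p; split=> //; split; split=> //.
  have := parabolic_schubert hpi hv; rewrite ei => /schubert_minor.
  by rewrite minor_insmx; apply.
have := parabolic_opp_schubert hpi hu; rewrite ei => /opp_schubert_schur.
by rewrite schur_insmx; apply.
Qed.

End Step.
End RichardsonStep.
End Richardson.

(** * Words and the Thompson relations *)

Section Words.
Variable R : realType.
Local Notation C := (R[i]).

Definition mk_letter (t : bool) (i : nat) : letter := if t then LT i else LR i.
Definition is_T (X : letter) : bool := if X is LT _ then true else false.
Definition lindex (X : letter) : nat := match X with LT j => j | LR j => j end.

Lemma is_T_mk t i : is_T (mk_letter t i) = t. Proof. by case: t. Qed.
Lemma lindex_mk t i : lindex (mk_letter t i) = i. Proof. by case: t. Qed.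

Lemma thRelP p q : thRel p q -> exists (t1 t2 : bool) (i j : nat),
  [/\ (0 < j)%N, (j + t2 <= i)%N, p = [:: mk_letter t1 i; mk_letter t2 j] &
      q = [:: mk_letter t2 j; mk_letter t1 i.+1]].
Proof.
move=> [i [j [j0 [[lt [-> ->]]|[le [-> ->]]|[lt [-> ->]]|[le [-> ->]]]]]].
- by exists true, true, i, j; rewrite addn1.
- by exists true, false, i, j; rewrite addn0.
- by exists false, true, i, j; rewrite addn1.
- by exists false, false, i, j; rewrite addn0.
Qed.

(* [r] is a reversed word, as in [uvRev]. *)
Fixpoint RTvalid (r : seq letter) : bool :=
  if r is X :: r' then
    [&& (0 < lindex X)%N, ((lindex X).-1 + is_T X <= size r')%N & RTvalid r']
  else true.

Lemma RTvalid_rev n w : RTSeq n w -> RTvalid (rev w).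
Proof.
move=> [<-] {n}; elim/last_ind: w => // w X IH; rewrite size_rcons rev_rcons => h /=.
rewrite IH ?andbT => [|k lt]; last first.
  by have := h k (leqW lt); rewrite nth_rcons lt.
have := h (size w) (leqnn _); rewrite nth_rcons ltnn eqxx size_rev.
by case: X {h} => j /=; lia.
Qed.

Lemma RTvalid_catr y r : RTvalid (y ++ r) -> RTvalid r.
Proof. by elim: y => //= X y IH /and3P[]. Qed.

Lemma RTvalid_cat y r1 r2 : size r1 = size r2 -> RTvalid r1 = RTvalid r2 ->
  RTvalid (y ++ r1) = RTvalid (y ++ r2).
Proof. by move=> es ev; elim: y => //= X y ->; rewrite !size_cat es. Qed.

(** The size [n] is independent of [r] and wrong sizes give the empty set, so the sets of two words
    are compared without casts. *)
Fixpoint flagset (r : seq letter) (n : nat) : 'M[C]_n -> Prop :=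
  match r with
  | [::] => fun _ => n = 0%N
  | X :: r' =>
      match n return 'M[C]_n -> Prop with
      | 0 => fun _ => False
      | n'.+1 => insert_step (is_T X) (inord (lindex X).-1) (@flagset r' n')
      end
  end.
Arguments flagset : clear implicits.

Lemma flagset_size r n g : flagset r n g -> n = size r.
Proof.
by elim: r n g => [|X r IH] [|n] g //= [h [p [/IH e _ _]]]; congr _.+1.
Qed.

Lemma insert_step_ext n t (i : 'I_n.+1) (S1 S2 : 'M[C]_n -> Prop) g :
  (forall h, S1 h <-> S2 h) -> insert_step t i S1 g <-> insert_step t i S2 g.
Proof.
move=> e; split=> -[h [p [Sh hp ->]]]; exists h, p; split=> //; exact/e.
Qed.

Lemma flagset_cat y r1 r2 : (forall n g, flagset r1 n g <-> flagset r2 n g) ->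
  forall n g, flagset (y ++ r1) n g <-> flagset (y ++ r2) n g.
Proof.
by move=> e; elim: y => //= X y IH [|n] g //; apply: insert_step_ext => h.
Qed.

Lemma flagset_comm (t1 t2 : bool) i j r :
  (0 < j)%N -> (j + t2 <= i)%N ->
  RTvalid [:: mk_letter t2 j, mk_letter t1 i & r] ->
  forall n g, flagset [:: mk_letter t2 j, mk_letter t1 i & r] n g <->
              flagset [:: mk_letter t1 i.+1, mk_letter t2 j & r] n g.
Proof.
move=> j0 le_ji hval n g.
have [e|/eqP ne] := eqVneq n (size r).+2; last by split=> /flagset_size.
subst n; move: hval => /=.
rewrite !is_T_mk !lindex_mk => /and5P[_ h1 i0 h2 _].
by apply: insert_step_comm; rewrite !inordK; lia.
Qed.

(** Intermediate words in a chain of relations are not assumed to be in [RTSeq], so length and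
    validity are carried through the induction. *)
Lemma thEq_flagset w w' : thEq w w' ->
  [/\ size w = size w', RTvalid (rev w) = RTvalid (rev w') &
      RTvalid (rev w) -> forall n g, flagset (rev w) n g <-> flagset (rev w') n g].
Proof.
elim=> {w w'} [w|w w' _ [es ev eY]|w1 w2 w3 _ [es1 ev1 e1] _ [es2 ev2 e2]|x y p q].
- by split.
- split=> // hw n g; apply: iff_sym; apply: eY; by rewrite ev.
- split; [by rewrite es1 | by rewrite ev1 | move=> hw n g].
  by apply: (iff_trans (e1 hw n g)); apply: e2; rewrite -ev1.
move=> /thRelP[t1 [t2 [i [j [j0 le ep eq]]]]].
have ew a b : rev (x ++ [:: a; b] ++ y) = rev y ++ [:: b, a & rev x].
  by rewrite !rev_cat -catA.
rewrite ep eq !ew; split; first by rewrite !size_cat.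
  apply: RTvalid_cat => //=; rewrite !is_T_mk !lindex_mk; case: (RTvalid _); lia.
by move=> /RTvalid_catr hval; apply/flagset_cat/flagset_comm.
Qed.

(** The inverse permutation inserts at row [j] and column 0, the Richardson step at row 0 and column
    [j]; the product inserts at [(j, j)]. *)
Lemma translate_lift_perm n (t : bool) (j k : 'I_n.+1) (u v : 'S_n) g :
  k = (j + t)%N :> nat ->
  translate (lift_perm j ord0 u)^-1%g
    (@richardson R n.+1 (lift_perm k ord0 v) (lift_perm j ord0 u)) g <->
  insert_step t j (translate u^-1%g (@richardson R n v u)) g.
Proof.
move=> ek; rewrite /translate lift_permV pmat_lift_perm; split.
  move=> [_ [/(richardson_lift_perm ek)[h [p [hh hp ->]]] ->]].
  exists (pmat R u^-1 *m h), p; split=> //; first by exists h.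
  by rewrite mulmxA mul_insmx.
move=> [_ [p [[h [hh ->]] hp ->]]]; exists (insmx ord0 j h *m p).
rewrite mulmxA mul_insmx; split=> //.
by apply/(richardson_lift_perm ek); exists h, p.
Qed.

Lemma translate_uvRev r g : RTvalid r ->
  translate (uvRev r).1^-1%g (@richardson R (size r) (uvRev r).2 (uvRev r).1) g <->
  flagset r (size r) g.
Proof.
elim: r g => [|X r IH] g; rewrite /=.
  move=> _; split=> // _; exists g; split; last by apply/matrixP; case.
  have u0 (h : 'M[C]_0) : h \in unitmx by rewrite unitmxE det_mx00 unitr1.
  have cl (S : 'M[C]_0 -> Prop) : S 1%:M -> zclosure S g.
    by move=> S1 f _ /(_ _ S1) <-; congr f; apply/matrixP; case.
  split; split=> //; apply: cl; exists 1%:M, 1%:M;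
    (split; [by split=> // -[] | split; [by split=> // -[] | by apply/matrixP; case]]).
move=> /and3P[p0 le hr].
have S := insert_step_ext (is_T X) (inord (lindex X).-1) g (fun h => IH h hr).
apply: (iff_trans _ S) => {S}.
(* The 0-based index is [j-1] for [u], and [j-1] or [j] for [v] according to the letter; validity
   puts them in the range of [inord]. *)
case: X g p0 le => j g /= j0 le; apply: translate_lift_perm; rewrite !inordK; lia.
Qed.

Lemma translate_XOf n w g : RTSeq n w ->
  translate (uOf n w)^-1%g (@XOf R n w) g <-> flagset (rev w) n g.
Proof.
move=> hw; have hval := RTvalid_rev hw.
have e0 : size (rev w) = n by rewrite size_rev; case: hw.
rewrite /XOf /uOf /vOf; case: eqP => // e; case: n / e {hw e0} g => g.
by rewrite !cast_perm_id; apply: translate_uvRev.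
Qed.

End Words.

Theorem mainTheorem3 (R : realType) (n : nat) (Om Om' : seq letter) :
  RTSeq n Om -> RTSeq n Om' -> thEq Om Om' ->
  forall g : 'M[R[i]]_n,
    translate ((uOf n Om)^-1)%g (@XOf R n Om) g <->
    translate ((uOf n Om')^-1)%g (@XOf R n Om') g.
Proof.
move=> hw hw' /(@thEq_flagset R)[_ _ e] g.
apply: (iff_trans (translate_XOf g hw)).
apply: (iff_trans (e (RTvalid_rev hw) n g)).
exact: iff_sym (translate_XOf g hw').
Qed.
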